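(* Let $n\ge 2$ be an integer and let $\Phi$ be a real $N\times d$ matrix satisfying the Restricted Isometry Condition with parameters $(4n,\varepsilon)$ for $\varepsilon = 0.01/\sqrt{\log n}$. Let $v\in\mathbb{R}^d$ be an $n$-sparse vector, let $e\in\mathbb{R}^N$ be an arbitrary vector, and let $x=\Phi v+e$. Let $\hat v$ be the reconstructed vector output by ROMP with measurement matrix $\Phi$, measurement vector $x$ and sparsity level $n$. Then $$\|v-\hat v\|_2\le 104\sqrt{\log n}\,\|e\|_2 .$$
   Context: $\log$ is the natural logarithm. For $v\in\mathbb{R}^d$, $\mathrm{supp}(v)$ is the set of indices of its nonzero coordinates; $v$ is $m$-sparse if $|\mathrm{supp}(v)|\le m$. For $I\subset\{1,\dots,d\}$, $v|_I$ denotes the restriction of $v$ to the coordinates in $I$ (extended by zero outside $I$ when viewed in $\mathbb{R}^d$), and $\mathbb{R}^I$ is identified with the vectors of $\mathbb{R}^d$ supported in $I$. Restricted Isometry Condition (RIC): a real $N\times d$ matrix $\Phi$ satisfies the RIC with parameters $(m,\varepsilon)$, $\varepsilon\in(0,1)$, if $(1-\varepsilon)\|v\|_2\le\|\Phi v\|_2\le(1+\varepsilon)\|v\|_2$ for all $m$-sparse vectors $v\in\mathbb{R}^d$. Regularized Orthogonal Matching Pursuit (ROMP) with matrix $\Phi$, measurement vector $x\in\mathbb{R}^N$ and sparsity level $s$: Initialize the index set $I=\emptyset$ and the residual $r=x$ (with $y=0$). Repeat the following steps $s$ times or until $|I|\ge 2s$ (whichever comes first). Identify: choose a set $J$ of the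 $s$ biggest nonzero coordinates in magnitude of the observation vector $u=\Phi^*r$, or all of its nonzero coordinates, whichever set is smaller. Regularize: among all subsets $J_0\subset J$ with comparable coordinates, i.e. $|u(i)|\le 2|u(j)|$ for all $i,j\in J_0$, choose $J_0$ with the maximal energy $\|u|_{J_0}\|_2$. Update: replace $I$ by $I\cup J_0$, and then set $y=\arg\min_{z\in\mathbb{R}^I}\|x-\Phi z\|_2$ and $r=x-\Phi y$. Output: the index set $I$ and the reconstructed vector $\hat v=y$. Ties are broken arbitrarily. *)

(* Defs.v *)
(* MathComp with MathComp-Analysis; reals are an arbitrary R : realType. *)
From mathcomp Require Import all_boot all_order all_algebra.
From mathcomp Require Import reals exp.

Set Implicit Arguments.
Unset Strict Implicit.
Unset Printing Implicit Defensive.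

Import Order.TTheory GRing.Theory Num.Theory.
Local Open Scope ring_scope.

(* The norm that the analysis library puts on matrices is the sup norm. *)
Definition norm2 (R : realType) (d : nat) (v : 'cV[R]_d) : R :=
  Num.sqrt (\sum_(i < d) v i 0 ^+ 2).

Definition supp (R : realType) (d : nat) (v : 'cV[R]_d) : {set 'I_d} :=
  [set i | v i 0 != 0].

Definition sparse (R : realType) (d m : nat) (v : 'cV[R]_d) : Prop :=
  (#|supp v| <= m)%N.

Definition restr (R : realType) (d : nat) (v : 'cV[R]_d) (I : {set 'I_d}) :
    'cV[R]_d :=
  \col_(i < d) (if i \in I then v i 0 else 0).

Definition RIC (R : realType) (N d : nat) (Phi : 'M[R]_(N, d))
    (m : nat) (eps : R) : Prop :=
  0 < eps < 1 /\
  forall v : 'cV[R]_d, sparse m v ->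
    (1 - eps) * norm2 v <= norm2 (Phi *m v) <= (1 + eps) * norm2 v.

(* All choices below are specified as relations, so that ties may be broken
   arbitrarily. *)

(* The cardinality condition forces J = supp u as soon as u has at most s
   nonzero coordinates. *)
Definition romp_identify (R : realType) (d s : nat) (u : 'cV[R]_d)
    (J : {set 'I_d}) : Prop :=
  [/\ J \subset supp u,
      #|J| = minn s #|supp u| &
      forall i j : 'I_d, i \in J -> j \notin J -> `|u j 0| <= `|u i 0|].

Definition comparable_on (R : realType) (d : nat) (u : 'cV[R]_d)
    (K : {set 'I_d}) : Prop :=
  forall i j : 'I_d, i \in K -> j \in K -> `|u i 0| <= 2 * `|u j 0|.

Definition romp_regularize (R : realType) (d : nat) (u : 'cV[R]_d)
    (J J0 : {set 'I_d}) : Prop :=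
  [/\ J0 \subset J,
      comparable_on u J0 &
      forall K : {set 'I_d}, K \subset J -> comparable_on u K ->
        norm2 (restr u K) <= norm2 (restr u J0)].

Definition least_squares (R : realType) (N d : nat) (Phi : 'M[R]_(N, d))
    (x : 'cV[R]_N) (I : {set 'I_d}) (y : 'cV[R]_d) : Prop :=
  supp y \subset I /\
  forall z : 'cV[R]_d, supp z \subset I ->
    norm2 (x - Phi *m y) <= norm2 (x - Phi *m z).

(* The state of the algorithm is (I, y); the residual is r = x - Phi *m y. *)
Definition romp_step (R : realType) (N d : nat) (Phi : 'M[R]_(N, d))
    (x : 'cV[R]_N) (s : nat) (I : {set 'I_d}) (y : 'cV[R]_d)
    (I' : {set 'I_d}) (y' : 'cV[R]_d) : Prop :=
  let u := Phi^T *m (x - Phi *m y) in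
  exists J J0 : {set 'I_d},
    [/\ romp_identify s u J,
        romp_regularize u J J0,
        I' = I :|: J0 &
        least_squares Phi x I' y'].

Inductive romp_run (R : realType) (N d : nat) (Phi : 'M[R]_(N, d))
    (x : 'cV[R]_N) (s : nat) : nat -> {set 'I_d} -> 'cV[R]_d -> Prop :=
| romp_init : romp_run Phi x s 0 set0 0
| romp_iter (k : nat) (I : {set 'I_d}) (y : 'cV[R]_d)
    (I' : {set 'I_d}) (y' : 'cV[R]_d) :
    romp_run Phi x s k I y ->
    (k < s)%N -> (#|I| < 2 * s)%N ->
    romp_step Phi x s I y I' y' ->
    romp_run Phi x s k.+1 I' y'.

Definition romp_output (R : realType) (N d : nat) (Phi : 'M[R]_(N, d))
    (x : 'cV[R]_N) (s : nat) (I : {set 'I_d}) (vhat : 'cV[R]_d) : Prop :=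
  exists2 k : nat, romp_run Phi x s k I vhat &
    k = s \/ (2 * s <= #|I|)%N.

(* Main.v *)
Require Import Defs.
From mathcomp Require Import all_boot all_order all_algebra.
From mathcomp Require Import reals exp.
From mathcomp Require Import ring lra zify.

Import Order.TTheory GRing.Theory Num.Theory.
Local Open Scope ring_scope.

(** Write S for the support of v, w = v - y for the current error,
u = Phi^T r for the observation vector, L = log n, s = sqrt L, and E for the
norm of the noise, so that eps * s = 1/100.

The restricted isometry condition makes vectors with disjoint supports almost
orthogonal under Phi ([RIC_dot_le]), and least squares makes the residual
r = Phi w + e orthogonal to the columns in I.  Two estimates follow:
- on S the observation is large: the norm of u on S is at least
  (1 - eps)^2 |w| - (1 + eps) E ([correlation_on_support_ge]);
- away from S and I it is small: the norm of u there is at most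
  2 eps |w| + (1 + eps) E ([correlation_off_support_le]).

The selected set J carries at least the energy of u on S
([identify_energy]), and the comparable subset J0 of maximal energy carries a
fraction of order 1 / L of that ([regularize_energy]), because J splits into
about log n dyadic levels of u and a negligible tail.  If at most half of J0
lay in S, comparability would leave a fixed fraction of the energy of J0
outside S, where u is small.  Combining the estimates,
  (1 - eps)^2 |w| - (1 + eps) E <= (11/2) s (2 eps |w| + (1 + eps) E),
and as s * eps = 1/100 the error on the right is absorbed on the left, whence
|w| <= 10 s E ([missed_step_error]).

So there are two cases ([romp_run_invariant]).  If some step catches too few
elements of S, then the part of v outside I has norm at most 10 s E from then
on, since I only grows.  Otherwise every step catches a new element of S and
at least half of all the selected indices lie in S; both stopping rules then
give n elements of S in I, hence all of S.  In either case the part of v missed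
by I is at most 10 s E, and a last least squares comparison
([least_squares_error]) turns this into a bound of order s E on the error,
well below 104 s E.  *)

(** * Euclidean geometry of column vectors *)
(** The matrix form makes bilinearity and the adjoint rule instances of the
laws of the matrix product. *)
Definition dot {R : realType} {d : nat} (a b : 'cV[R]_d) : R :=
  (a^T *m b) 0 0.

Lemma dotE {R : realType} {d : nat} (a b : 'cV[R]_d) :
  dot a b = \sum_(i < d) a i 0 * b i 0.
Proof. by rewrite /dot mxE; apply: eq_bigr => i _; rewrite mxE. Qed.

Lemma dotC {R : realType} {d : nat} (a b : 'cV[R]_d) : dot a b = dot b a.
Proof. by rewrite !dotE; apply: eq_bigr => i _; rewrite mulrC. Qed.

Lemma dotDr {R : realType} {d : nat} (a b c : 'cV[R]_d) :
  dot a (b + c) = dot a b + dot a c.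
Proof. by rewrite /dot mulmxDr mxE. Qed.

Lemma dotZr {R : realType} {d : nat} (k : R) (a b : 'cV[R]_d) :
  dot a (k *: b) = k * dot a b.
Proof. by rewrite /dot -scalemxAr mxE. Qed.

Lemma dotNr {R : realType} {d : nat} (a b : 'cV[R]_d) :
  dot a (- b) = - dot a b.
Proof. by rewrite /dot mulmxN mxE. Qed.

Lemma dotDl {R : realType} {d : nat} (a b c : 'cV[R]_d) :
  dot (a + b) c = dot a c + dot b c.
Proof. by rewrite dotC dotDr !(dotC c). Qed.

Lemma dotZl {R : realType} {d : nat} (k : R) (a b : 'cV[R]_d) :
  dot (k *: a) b = k * dot a b.
Proof. by rewrite dotC dotZr dotC. Qed.

Lemma dotNl {R : realType} {d : nat} (a b : 'cV[R]_d) :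
  dot (- a) b = - dot a b.
Proof. by rewrite dotC dotNr dotC. Qed.

Lemma dot_mulmxl {R : realType} {N d : nat} (A : 'M[R]_(N, d))
    (a : 'cV[R]_d) (b : 'cV[R]_N) :
  dot (A *m a) b = dot a (A^T *m b).
Proof. by rewrite /dot trmx_mul mulmxA. Qed.

Lemma norm2_ge0 {R : realType} {d : nat} (a : 'cV[R]_d) : 0 <= norm2 a.
Proof. exact: sqrtr_ge0. Qed.

Lemma norm2_sqr {R : realType} {d : nat} (a : 'cV[R]_d) :
  norm2 a ^+ 2 = dot a a.
Proof.
rewrite sqr_sqrtr; first by rewrite dotE; apply: eq_bigr => i _; rewrite expr2.
by apply: sumr_ge0 => i _; apply: sqr_ge0.
Qed.

Lemma norm2_0 {R : realType} {d : nat} : norm2 (0 : 'cV[R]_d) = 0.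
Proof. by apply/eqP; rewrite -sqrf_eq0 norm2_sqr /dot mulmx0 mxE. Qed.

Lemma norm2_eq0 {R : realType} {d : nat} (a : 'cV[R]_d) :
  norm2 a = 0 -> a = 0.
Proof.
move=> a0; have := norm2_sqr a; rewrite a0 expr0n /= dotE => /esym/eqP.
rewrite psumr_eq0 => [/allP sum0|i _]; last by rewrite -expr2 sqr_ge0.
apply/colP => i; rewrite mxE; apply/eqP.
by have := sum0 i (mem_index_enum i); rewrite /= mulf_eq0 orbb.
Qed.

(** Cauchy-Schwarz, by expanding the square of the norm of |b| a - |a| b. *)
Lemma dot_le_norm2 {R : realType} {d : nat} (a b : 'cV[R]_d) :
  dot a b <= norm2 a * norm2 b.
Proof.
have [a0|an0] := eqVneq (norm2 a) 0.
  by rewrite a0 (norm2_eq0 _ a0) -(scale0r 0) dotZl !mul0r.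
have [b0|bn0] := eqVneq (norm2 b) 0.
  by rewrite b0 (norm2_eq0 _ b0) -(scale0r 0) dotZr mulr0 mul0r.
have ab_gt0 : 0 < norm2 a * norm2 b.
  by rewrite mulr_gt0 // lt0r ?an0 ?bn0 norm2_ge0.
have := sqr_ge0 (norm2 (norm2 b *: a - norm2 a *: b)).
rewrite norm2_sqr !(dotDl, dotDr, dotNl, dotNr, dotZl, dotZr).
rewrite -!norm2_sqr (dotC b a) => sq_ge0.
rewrite -(ler_pM2l ab_gt0); nra.
Qed.

Lemma norm2N {R : realType} {d : nat} (a : 'cV[R]_d) : norm2 (- a) = norm2 a.
Proof. by congr Num.sqrt; apply: eq_bigr => i _; rewrite mxE sqrrN. Qed.

Lemma norm2D {R : realType} {d : nat} (a b : 'cV[R]_d) :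
  norm2 (a + b) <= norm2 a + norm2 b.
Proof.
rewrite -ler_sqr ?nnegrE ?addr_ge0 ?norm2_ge0 // norm2_sqr.
rewrite !(dotDl, dotDr) (dotC b a) sqrrD -!norm2_sqr.
have := dot_le_norm2 a b; lra.
Qed.

(** * Supports and restrictions *)
Lemma suppD {R : realType} {d : nat} (a b : 'cV[R]_d) :
  supp (a + b) \subset supp a :|: supp b.
Proof.
apply/subsetP => i; rewrite !inE mxE; apply: contraR.
by rewrite negb_or !negbK => /andP[/eqP-> /eqP->]; rewrite addr0.
Qed.

Lemma suppN {R : realType} {d : nat} (a : 'cV[R]_d) : supp (- a) = supp a.
Proof. by apply/setP => i; rewrite !inE mxE oppr_eq0. Qed.

Lemma suppZ {R : realType} {d : nat} (k : R) (a : 'cV[R]_d) :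
  supp (k *: a) \subset supp a.
Proof.
by apply/subsetP => i; rewrite !inE mxE mulf_eq0 negb_or => /andP[].
Qed.

Lemma supp_restr {R : realType} {d : nat} (a : 'cV[R]_d) (I : {set 'I_d}) :
  supp (restr a I) \subset I.
Proof. by apply/subsetP => i; rewrite !inE mxE; case: ifP; rewrite ?eqxx. Qed.

Lemma supp_subset_eq0 {R : realType} {d : nat} (a : 'cV[R]_d)
    (I : {set 'I_d}) i :
  supp a \subset I -> i \notin I -> a i 0 = 0.
Proof.
move=> /subsetP aI; apply: contraNeq => ai0.
by apply: aI; rewrite inE.
Qed.

Lemma supp_restr_sub {R : realType} {d : nat} (a : 'cV[R]_d)
    (I : {set 'I_d}) :
  supp (restr a I) \subset supp a.
Proof. by apply/subsetP => i; rewrite !inE mxE; case: ifP; rewrite ?eqxx. Qed.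

Lemma restr_setC_eq0 {R : realType} {d : nat} (a : 'cV[R]_d)
    (I : {set 'I_d}) :
  supp a \subset I -> restr a (~: I) = 0.
Proof.
move=> aI; apply/colP => i; rewrite !mxE inE.
by case: ifPn => // /(supp_subset_eq0 _ _ _ aI).
Qed.

Lemma restr_setC_subr {R : realType} {d : nat} (a b : 'cV[R]_d)
    (I : {set 'I_d}) :
  supp b \subset I -> restr (a - b) (~: I) = restr a (~: I).
Proof.
move=> bI; apply/colP => i; rewrite !mxE inE.
by case: ifPn => // /(supp_subset_eq0 _ _ _ bI)->; rewrite subr0.
Qed.

Lemma sub_restr {R : realType} {d : nat} (a : 'cV[R]_d) (I : {set 'I_d}) :
  a - restr a I = restr a (~: I).
Proof.
by apply/colP => i; rewrite !mxE inE; case: ifP; rewrite ?subrr ?subr0.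
Qed.

Lemma sparse_supp_subset {R : realType} {d m : nat} (a : 'cV[R]_d) (I : {set 'I_d}) :
  supp a \subset I -> (#|I| <= m)%N -> sparse m a.
Proof. by move=> /subset_leq_card; apply: leq_trans. Qed.

Lemma norm2_restr_sqr {R : realType} {d : nat} (a : 'cV[R]_d)
    (I : {set 'I_d}) :
  norm2 (restr a I) ^+ 2 = \sum_(i in I) a i 0 ^+ 2.
Proof.
rewrite norm2_sqr dotE [RHS]big_mkcond; apply: eq_bigr => i _.
by rewrite mxE; case: ifP; rewrite ?mulr0 // expr2.
Qed.

Lemma dot_restr {R : realType} {d : nat} (a b : 'cV[R]_d) (I : {set 'I_d}) :
  supp a \subset I -> dot a b = dot a (restr b I).
Proof.
move=> aI; rewrite !dotE; apply: eq_bigr => i _; rewrite mxE.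
by case: ifPn => // /(supp_subset_eq0 _ _ _ aI)->; rewrite !mul0r.
Qed.

Lemma norm2_restr_le {R : realType} {d : nat} (a : 'cV[R]_d)
    (I K : {set 'I_d}) :
  I \subset K -> norm2 (restr a I) <= norm2 (restr a K).
Proof.
move=> /subsetP IK; rewrite -ler_sqr ?nnegrE ?norm2_ge0 // !norm2_restr_sqr.
rewrite [leLHS]big_mkcond [leRHS]big_mkcond; apply: ler_sum => i _.
by case: ifPn => [/IK->//|_]; case: ifP; rewrite ?sqr_ge0.
Qed.

Lemma norm2_restr_le_full {R : realType} {d : nat} (a : 'cV[R]_d)
    (I : {set 'I_d}) :
  norm2 (restr a I) <= norm2 a.
Proof.
have -> : norm2 a = norm2 (restr a setT).
  by congr norm2; apply/colP => i; rewrite mxE inE.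
exact/norm2_restr_le/subsetT.
Qed.

(** * Consequences of restricted isometry and of least squares *)

(** By polarization: once z and w are scaled to a common norm, z + w and z - w
have the same norm q because z and w are orthogonal.  The squared norms of their
images under Phi thus differ by at most ((1 + eps)^2 - (1 - eps)^2) q^2
= 4 eps q^2, and this difference is four times the inner product. *)
Lemma RIC_dot_le {R : realType} {N d m : nat} (Phi : 'M[R]_(N, d)) (eps : R)
    (z w : 'cV[R]_d) (K : {set 'I_d}) :
  RIC Phi m eps -> (#|K| <= m)%N -> supp z \subset K -> supp w \subset K ->
  dot z w = 0 ->
  dot (Phi *m z) (Phi *m w) <= 2 * eps * norm2 z * norm2 w.
Proof.
move=> [/andP[eps_gt0 eps_lt1] ric] Km zK wK zw0.
have [z0|zn0] := eqVneq (norm2 z) 0.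
  by rewrite z0 (norm2_eq0 _ z0) mulmx0 -(scale0r 0) dotZl !(mulr0, mul0r).
have [w0|wn0] := eqVneq (norm2 w) 0.
  by rewrite w0 (norm2_eq0 _ w0) mulmx0 -(scale0r 0) dotZr !(mulr0, mul0r).
have zw_gt0 : 0 < norm2 z * norm2 w.
  by rewrite mulr_gt0 // lt0r ?zn0 ?wn0 norm2_ge0.
have sparseP (k l : R) : sparse m (k *: z + l *: w).
  apply: (sparse_supp_subset _ _ _ Km); apply: subset_trans (suppD _ _) _.
  by rewrite subUset (subset_trans (suppZ _ _) zK) (subset_trans (suppZ _ _) wK).
have upper := ric _ (sparseP (norm2 w) (norm2 z)).
have lower := ric _ (sparseP (norm2 w) (- norm2 z)).
have {upper} : norm2 (Phi *m (norm2 w *: z + norm2 z *: w)) ^+ 2 <=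
    ((1 + eps) * norm2 (norm2 w *: z + norm2 z *: w)) ^+ 2.
  have /andP[_ le_up] := upper.
  by rewrite ler_sqr // nnegrE ?mulr_ge0 ?norm2_ge0 // addr_ge0 // ltW.
have {lower} : ((1 - eps) * norm2 (norm2 w *: z + - norm2 z *: w)) ^+ 2 <=
    norm2 (Phi *m (norm2 w *: z + - norm2 z *: w)) ^+ 2.
  have /andP[le_low _] := lower.
  by rewrite ler_sqr // nnegrE ?mulr_ge0 ?norm2_ge0 // subr_ge0 ltW.
rewrite !exprMn !norm2_sqr !mulmxDr -!scalemxAr.
rewrite !(dotDl, dotDr, dotZl, dotZr) (dotC (Phi *m w)) (dotC w z) zw0.
rewrite -!norm2_sqr => lower upper.
rewrite -(ler_pM2l zw_gt0); nra.
Qed.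

(** The normal equations: moving y by t z cannot decrease the residual, for any
t. *)
Lemma least_squares_ortho {R : realType} {N d : nat} (Phi : 'M[R]_(N, d))
    (x : 'cV[R]_N) (I : {set 'I_d}) (y z : 'cV[R]_d) :
  least_squares Phi x I y -> supp z \subset I ->
  dot (Phi *m z) (x - Phi *m y) = 0.
Proof.
move=> [yI ymin] zI; set r := x - _; set b := dot _ r.
pose c := norm2 (Phi *m z) ^+ 2.
(* The optimal step is b / c; adding 1 covers the case c = 0. *)
pose t := b / (c + 1).
have c_ge0 : 0 <= c by apply: sqr_ge0.
have c1_gt0 : 0 < c + 1 by rewrite ltr_wpDl.
have /ymin : supp (y + t *: z) \subset I.
  apply: subset_trans (suppD _ _) _.
  by rewrite subUset yI (subset_trans (suppZ _ _) zI).
rewrite mulmxDr -scalemxAr opprD addrA -/r; move: r @b @t => r b t.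
rewrite -ler_sqr ?nnegrE ?norm2_ge0 // !norm2_sqr.
rewrite !(dotDl, dotDr, dotNl, dotNr, dotZl, dotZr) (dotC r) -/b.
rewrite -(norm2_sqr (Phi *m z)) -/c => le_r.
have bE : b = t * (c + 1) by rewrite divfK // gt_eqF.
have t2_le0 : t ^+ 2 <= 0.
  have : 0 <= c * t ^+ 2 by rewrite mulr_ge0 ?sqr_ge0.
  move: le_r; rewrite bE; nra.
have : t == 0 by rewrite -sqrf_eq0 eq_le t2_le0 sqr_ge0.
by rewrite bE => /eqP->; rewrite mul0r.
Qed.

Lemma least_squares_correlation0 {R : realType} {N d : nat}
    (Phi : 'M[R]_(N, d)) (x : 'cV[R]_N) (I : {set 'I_d}) (y : 'cV[R]_d) i :
  least_squares Phi x I y -> i \in I -> (Phi^T *m (x - Phi *m y)) i 0 = 0.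
Proof.
move=> ls iI; have deltaI : supp (delta_mx i 0 : 'cV[R]_d) \subset I.
  apply/subsetP => j; rewrite inE mxE andbT.
  by case: (j =P i) => [->//|]; rewrite eqxx.
have := least_squares_ortho _ _ _ _ _ ls deltaI.
rewrite dot_mulmxl dotE (bigD1 i) //= mxE !eqxx mul1r big1 ?addr0 //.
by move=> j ji; rewrite mxE (negbTE ji) mul0r.
Qed.

(** The restriction z of the observation to T satisfies
|z|^2 = <Phi z, Phi w> + <Phi z, e>, and its support avoids that of w, so the
first term is small by near orthogonality. *)
Lemma correlation_off_support_le {R : realType} {N d m : nat} (Phi : 'M[R]_(N, d))
    (eps : R) (w : 'cV[R]_d) (e : 'cV[R]_N) (T K : {set 'I_d}) :
  RIC Phi m eps -> supp w \subset K -> [disjoint T & K] ->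
  (#|T :|: K| <= m)%N ->
  norm2 (restr (Phi^T *m (Phi *m w + e)) T) <=
    2 * eps * norm2 w + (1 + eps) * norm2 e.
Proof.
move=> ric wK TK Km; set z := restr _ T; have zT : supp z \subset T.
  exact: supp_restr.
have [/andP[eps_gt0 _] ricP] := ric.
have zw0 : dot z w = 0.
  rewrite dotE big1 // => i _; rewrite mxE; case: ifPn => [iT|_]; last first.
    by rewrite mul0r.
  by rewrite (supp_subset_eq0 _ _ _ wK) ?mulr0 // (disjointFr TK iT).
have near_ortho := RIC_dot_le _ _ _ _ _ ric Km
  (subset_trans zT (subsetUl _ _)) (subset_trans wK (subsetUr _ _)) zw0.
have noise := dot_le_norm2 (Phi *m z) e.
have /andP[_ Phiz] : (1 - eps) * norm2 z <= norm2 (Phi *m z) <= (1 + eps) * norm2 z.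
  apply: ricP; apply: sparse_supp_subset zT _.
  by apply: leq_trans Km; apply/subset_leq_card/subsetUl.
have energy : norm2 z ^+ 2 = dot (Phi *m z) (Phi *m w) + dot (Phi *m z) e.
  by rewrite -dotDr dot_mulmxl norm2_sqr /z -dot_restr.
have [z0|zn0] := eqVneq (norm2 z) 0.
  by rewrite z0 addr_ge0 // !mulr_ge0 ?norm2_ge0 // ?addr_ge0 // ltW.
have z_gt0 : 0 < norm2 z by rewrite lt0r zn0 norm2_ge0.
have Phiz_e := ler_wpM2r (norm2_ge0 e) Phiz.
rewrite -(ler_pM2l z_gt0) -expr2 energy; lra.
Qed.

(** The error w is v0 = v restricted to the complement of I, up to a vector
supported in I, to which the residual is orthogonal.  Hence
<u, v0> = <r, Phi w> = |Phi w|^2 + <e, Phi w>, of order |w|^2, while v0 is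
supported in S and is no longer than w. *)
Lemma correlation_on_support_ge {R : realType} {N d m : nat} (Phi : 'M[R]_(N, d))
    (eps : R) (v y : 'cV[R]_d) (e : 'cV[R]_N) (I S : {set 'I_d}) :
  RIC Phi m eps -> supp v \subset S -> (#|S :|: I| <= m)%N ->
  least_squares Phi (Phi *m v + e) I y ->
  (1 - eps) ^+ 2 * norm2 (v - y) - (1 + eps) * norm2 e <=
    norm2 (restr (Phi^T *m (Phi *m v + e - Phi *m y)) S).
Proof.
move=> [/andP[eps_gt0 eps_lt1] ric] vS Sm ls; have [yI _] := ls.
set r := Phi *m v + e - _; set w := v - y; set a := norm2 (restr _ _).
have rE : r = Phi *m w + e by rewrite /r /w mulmxBr addrAC.
have wSI : supp w \subset S :|: I.
  by apply: subset_trans (suppD _ _) _; rewrite suppN setUSS.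
pose v0 := restr v (~: I).
have v0E : restr w (~: I) = v0 by apply: restr_setC_subr.
have v0S : supp v0 \subset S.
  exact: subset_trans (supp_restr_sub _ _) vS.
have w1I : supp (w - v0) \subset I.
  by rewrite -v0E sub_restr setCK supp_restr.
have v0w : norm2 v0 <= norm2 w by rewrite -v0E norm2_restr_le_full.
have /andP[low up] := ric w (sparse_supp_subset _ _ wSI Sm).
have correl : dot v0 (restr (Phi^T *m r) S) = norm2 (Phi *m w) ^+ 2 + dot (Phi *m w) e.
  rewrite -dot_restr // -dot_mulmxl norm2_sqr -dotDr -rE.
  have := least_squares_ortho _ _ _ _ _ ls w1I; rewrite -/r mulmxBr dotDl dotNl.
  by move/eqP; rewrite subr_eq0 => /eqP.
have := dot_le_norm2 v0 (restr (Phi^T *m r) S); rewrite correl -/a => le_a.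
have a_ge0 : 0 <= a by apply: norm2_ge0.
have e_ge0 := norm2_ge0 e.
have [w0|wn0] := eqVneq (norm2 w) 0.
  by rewrite w0 mulr0 sub0r (le_trans _ a_ge0) // oppr_le0 mulr_ge0 // addr_ge0 // ltW.
have w_gt0 : 0 < norm2 w by rewrite lt0r wn0 norm2_ge0.
have low2 : ((1 - eps) * norm2 w) ^+ 2 <= norm2 (Phi *m w) ^+ 2.
  by rewrite ler_sqr // nnegrE ?norm2_ge0 // mulr_ge0 ?norm2_ge0 // subr_ge0 ltW.
have noise : - (norm2 (Phi *m w) * norm2 e) <= dot (Phi *m w) e.
  by rewrite lerNl -dotNr -(norm2N e) dot_le_norm2.
have up_e := ler_wpM2r e_ge0 up.
have v0w_a := ler_wpM2r a_ge0 v0w.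
rewrite -(ler_pM2l w_gt0); rewrite exprMn in low2; lra.
Qed.

(** Compare y with the competitor v restricted to I, whose residual is Phi
applied to the missed part of v, plus the noise. *)
Lemma least_squares_error {R : realType} {N d m : nat} (Phi : 'M[R]_(N, d))
    (eps : R) (v y : 'cV[R]_d) (e : 'cV[R]_N) (I : {set 'I_d}) :
  RIC Phi m eps -> (#|supp v :|: I| <= m)%N ->
  least_squares Phi (Phi *m v + e) I y ->
  (1 - eps) * norm2 (v - y) <=
    (1 + eps) * norm2 (restr v (~: I)) + 2 * norm2 e.
Proof.
move=> [_ ric] vIm [yI ymin].
have /andP[low _] : (1 - eps) * norm2 (v - y) <= norm2 (Phi *m (v - y)) <=
    (1 + eps) * norm2 (v - y).
  apply: ric; apply: sparse_supp_subset vIm.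
  by apply: subset_trans (suppD _ _) _; rewrite suppN setUSS.
have /andP[_ up] : (1 - eps) * norm2 (restr v (~: I)) <=
    norm2 (Phi *m restr v (~: I)) <= (1 + eps) * norm2 (restr v (~: I)).
  apply: ric; apply: sparse_supp_subset vIm.
  exact: subset_trans (supp_restr_sub _ _) (subsetUl _ _).
have := ymin (restr v I) (supp_restr _ _).
have -> : Phi *m v + e - Phi *m restr v I = Phi *m restr v (~: I) + e.
  by rewrite addrAC -mulmxBr sub_restr.
have := norm2D (Phi *m restr v (~: I)) e.
have : norm2 (Phi *m (v - y)) <= norm2 (Phi *m v + e - Phi *m y) + norm2 e.
  rewrite -(norm2N e); apply: le_trans (norm2D _ _); rewrite mulmxBr.
  by rewrite addrAC addrK.
lra.
Qed.

(** * Energy kept by identification and regularization *)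
Lemma sum_le_sum_pairwise {R : realType} {d : nat} (f g : 'I_d -> R)
    (A B : {set 'I_d}) :
  (#|A| <= #|B|)%N -> (forall i, 0 <= g i) ->
  (forall i j, i \in A -> j \in B -> f i <= g j) ->
  \sum_(i in A) f i <= \sum_(j in B) g j.
Proof.
move=> AB g_ge0 fg; have [B0|B_gt0] := posnP #|B|.
  move: AB; rewrite B0 leqn0 cards_eq0 => /eqP->.
  by rewrite big_set0 sumr_ge0.
(* Summing the hypothesis over all pairs yields |B| times the left sum and at
   most |B| times the right one. *)
have : \sum_(i in A) \sum_(j in B) f i <= \sum_(i in A) \sum_(j in B) g j.
  by apply: ler_sum => i iA; apply: ler_sum => j jB; apply: fg.
rewrite sumr_const (eq_bigr _ (fun i _ => sumr_const _ _)) sumrMnl => le_AB.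
by rewrite -(ler_pMn2r B_gt0) (le_trans le_AB) // ler_wpMn2l ?sumr_ge0.
Qed.

(** By the normal equations the observation vanishes on I, and J selects only
nonzero coordinates. *)
Lemma identify_disjoint {R : realType} {N d s : nat} (Phi : 'M[R]_(N, d))
    (x : 'cV[R]_N) (y : 'cV[R]_d) (I J : {set 'I_d}) :
  least_squares Phi x I y -> romp_identify s (Phi^T *m (x - Phi *m y)) J ->
  [disjoint I & J].
Proof.
move=> ls [Ju _ _]; rewrite disjoint_subset; apply/subsetP => i iI.
rewrite inE; apply/negP => /(subsetP Ju); rewrite inE.
by rewrite (least_squares_correlation0 _ _ _ _ _ ls iI) eqxx.
Qed.

(** Outside J, the nonzero coordinates of S are at most as many as those of J
outside S, and each is dominated by each of the latter. *)
Lemma identify_energy {R : realType} {d s : nat} (u : 'cV[R]_d)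
    (J S : {set 'I_d}) :
  romp_identify s u J -> (#|S| <= s)%N ->
  norm2 (restr u S) <= norm2 (restr u J).
Proof.
move=> [Ju Jcard Jbig] Ss; rewrite -ler_sqr ?nnegrE ?norm2_ge0 //.
rewrite !norm2_restr_sqr; set T := S :&: supp u.
have -> : \sum_(i in S) u i 0 ^+ 2 = \sum_(i in T) u i 0 ^+ 2.
  rewrite big_mkcond [RHS]big_mkcond; apply: eq_bigr => i _.
  rewrite in_setI inE; case: (i \in S) => //=.
  by case: eqP => //= ->; rewrite expr0n.
have TJ : (#|T :\: J| <= #|J :\: T|)%N.
  have : (#|T| <= #|J|)%N.
    rewrite Jcard leq_min (leq_trans _ Ss) ?subset_leq_card ?subsetIl //.
    by rewrite subsetIr.
  by rewrite -(cardsID J T) -(cardsID T J) (setIC J) leq_add2l.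
rewrite (big_setID J) [leRHS](big_setID T) /= (setIC J) lerD2l.
apply: sum_le_sum_pairwise => // [i|i j]; first exact: sqr_ge0.
rewrite !inE => /andP[iJ _] /andP[_ jJ].
rewrite -(real_normK (num_real (u i 0))) -(real_normK (num_real (u j 0))).
by rewrite ler_sqr ?nnegrE ?normr_ge0 // Jbig.
Qed.

(** Let g be the energy norm of J0.  Singletons are comparable, so maximality
bounds every coordinate on J by g.  The coordinates between g / 2^(k+1) and
g / 2^k are comparable as well, so each of the levels k < p has energy at most
g^2; the coordinates below g / 2^p, at most 2^p of them, add at most g^2
again. *)
Lemma regularize_energy {R : realType} {d p : nat} (u : 'cV[R]_d)
    (J J0 : {set 'I_d}) :
  romp_regularize u J J0 -> (#|J| <= 2 ^ p)%N ->
  norm2 (restr u J) ^+ 2 <= p.+1%:R * norm2 (restr u J0) ^+ 2.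
Proof.
move=> [_ _ J0max] Jp; set g := norm2 (restr u J0).
have g_ge0 : 0 <= g by apply: norm2_ge0.
have sqrE i : `|u i 0| ^+ 2 = u i 0 ^+ 2 by rewrite real_normK ?num_real.
have coord_le i : i \in J -> `|u i 0| <= g.
  move=> iJ; have : norm2 (restr u [set i]) <= g.
    apply: J0max; first by rewrite sub1set.
    by move=> j k /set1P-> /set1P->; rewrite ler_peMl // ler1n.
  apply: le_trans; rewrite -ler_sqr ?nnegrE ?norm2_ge0 //.
  by rewrite norm2_restr_sqr big_set1 sqrE.
(* Splitting off the k largest levels. *)
have peel k : norm2 (restr u J) ^+ 2 <= k%:R * g ^+ 2 +
    \sum_(i in J | `|u i 0| <= g / 2 ^+ k) u i 0 ^+ 2.
  elim: k => [|k IHk].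
    rewrite mul0r add0r norm2_restr_sqr expr0 divr1 le_eqVlt; apply/orP; left.
    by apply/eqP/eq_bigl => i; case: (boolP (i \in J)) => //= /coord_le->.
  apply: (le_trans IHk); rewrite -[k.+1%:R]natr1 mulrDl mul1r -addrA lerD2l.
  pose A := [set i in J | g / 2 ^+ k.+1 < `|u i 0| <= g / 2 ^+ k].
  have gk : g / 2 ^+ k = 2 * (g / 2 ^+ k.+1).
    by rewrite exprS invfM mulrCA mulVKf ?pnatr_eq0.
  have gk1 : 0 <= g / 2 ^+ k.+1 by rewrite divr_ge0 ?exprn_ge0.
  (* First the coordinates outside level k, then the comparable set A. *)
  rewrite (bigID (fun i => i \in A)) /= lerD //; last first.
    rewrite big_mkcond [leRHS]big_mkcond; apply: ler_sum => i _.
    rewrite inE; case: (i \in J) => //=.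
    case: (leP `|u i 0| (g / 2 ^+ k.+1)) => _ /=; last by rewrite andbN.
    by case: ifP; rewrite ?sqr_ge0.
  rewrite (eq_bigl (fun i => i \in A)) => [|i]; last first.
    by rewrite inE; case: (i \in J) => //=; rewrite andbCA andbb.
  rewrite -norm2_restr_sqr ler_sqr ?nnegrE ?norm2_ge0 //.
  apply: J0max; first by apply/subsetP => i; rewrite inE => /andP[].
  move=> i j; rewrite !inE => /and3P[_ _ ui] /and3P[_ uj _].
  by apply: le_trans ui _; rewrite gk ler_pM2l // ltW.
apply: le_trans (peel p) _; rewrite -[p.+1%:R]natr1 mulrDl mul1r lerD2l.
have tail i : `|u i 0| <= g / 2 ^+ p -> u i 0 ^+ 2 <= g ^+ 2 / (2 ^ p)%:R.
  move=> ui; rewrite -sqrE; have p2_gt0 : 0 < (2 : R) ^+ p by rewrite exprn_gt0.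
  apply: le_trans (_ : (g / 2 ^+ p) ^+ 2 <= _).
    by rewrite ler_sqr ?nnegrE // divr_ge0 // ltW.
  rewrite natrX exprMn ler_wpM2l ?sqr_ge0 // expr2 ler_piMl ?invr_ge0 ?(ltW p2_gt0) //.
  by rewrite invf_le1 // exprn_ege1 // ler1n.
apply: le_trans (_ : \sum_(i in J) g ^+ 2 / (2 ^ p)%:R <= _).
  rewrite big_mkcondr; apply: ler_sum => i _; case: ifP => [/tail//|_].
  by rewrite divr_ge0 ?sqr_ge0 // ler0n.
rewrite sumr_const -[leLHS]mulr_natr -mulrA ler_piMr ?sqr_ge0 //.
by rewrite mulrC ler_pdivrMr ?mul1r ?ler_nat // ltr0n expn_gt0.
Qed.


Lemma ln2_ge_half {R : realType} : 1 / 2 <= ln 2 :> R.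
Proof.
have : ln (1 + - (1 / 2)) <= - (1 / 2) :> R by apply: le_ln1Dx; lra.
have -> : 1 + - (1 / 2) = 2^-1 :> R by field.
by rewrite lnV ?posrE // lerN2.
Qed.

(** With 2^(p-1) <= n < 2^p we have p + 1 <= log n / log 2 + 2, and both terms
are controlled by log n because log n >= log 2 >= 1/2. *)
Lemma exists_dyadic_bound {R : realType} (n : nat) : (2 <= n)%N ->
  exists2 p : nat, (n <= 2 ^ p)%N & p.+1%:R <= 6 * ln (n%:R : R).
Proof.
move=> n_ge2; have n_gt0 : (0 < n)%N by apply: leq_trans n_ge2.
exists (trunc_log 2 n).+1; first by rewrite ltnW // trunc_log_ltn.
have ln2n : ln 2 <= ln (n%:R : R) by rewrite ler_ln ?posrE ?ltr0n // ler_nat.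
have : ln ((2 : R) ^+ trunc_log 2 n) <= ln (n%:R : R).
  by rewrite ler_ln ?posrE ?exprn_gt0 ?ltr0n // -natrX ler_nat trunc_logP.
rewrite lnXn // -[ln 2 *+ _]mulr_natl => le_ln; have half := @ln2_ge_half R.
have := ler_wpM2l (ler0n R (trunc_log 2 n)) half.
rewrite -[(trunc_log 2 n).+2]addn2 natrD; lra.
Qed.

(** Each squared coordinate of K in S is at most 4 times each squared coordinate
of K outside S, and there are at least as many of the latter. *)
Lemma comparable_energy {R : realType} {d : nat} (u : 'cV[R]_d)
    (K S : {set 'I_d}) :
  comparable_on u K -> (#|K :&: S| <= #|K :\: S|)%N ->
  norm2 (restr u K) ^+ 2 <= 5 * norm2 (restr u (K :\: S)) ^+ 2.
Proof.
move=> ucomp half; rewrite !norm2_restr_sqr (big_setID S) /=.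
have : \sum_(i in K :&: S) u i 0 ^+ 2 <= \sum_(j in K :\: S) 4 * u j 0 ^+ 2.
  apply: sum_le_sum_pairwise => // [i|i j]; first by rewrite mulr_ge0 ?sqr_ge0.
  rewrite !inE => /andP[iK _] /andP[_ jK]; have := ucomp i j iK jK.
  rewrite -ler_sqr ?nnegrE ?mulr_ge0 ?normr_ge0 // exprMn.
  by rewrite !real_normK ?num_real //; lra.
rewrite -mulr_sumr; lra.
Qed.

(** * Progress of the iteration *)

(** A step in which S does not hold the majority of J0 can only occur once the
error is already of the order of the noise.  An empty J0, which arises when the
observation vanishes, falls under this case too. *)
Lemma missed_step_error {R : realType} {N d n : nat} (Phi : 'M[R]_(N, d))
    (s eps : R) (v y : 'cV[R]_d) (e : 'cV[R]_N) (I J J0 : {set 'I_d}) :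
  (2 <= n)%N -> 0 <= s -> s ^+ 2 = ln n%:R -> eps * s = 1 / 100 ->
  RIC Phi (4 * n)%N eps -> sparse n v -> (#|I| <= 2 * n)%N ->
  least_squares Phi (Phi *m v + e) I y ->
  romp_identify n (Phi^T *m (Phi *m v + e - Phi *m y)) J ->
  romp_regularize (Phi^T *m (Phi *m v + e - Phi *m y)) J J0 ->
  (#|J0 :&: supp v| <= #|J0 :\: supp v|)%N ->
  norm2 (v - y) <= 10 * s * norm2 e.
Proof.
move=> n_ge2 s_ge0 sE eps_s ric vn I2n ls ident regul half.
have [yI _] := ls; have [/andP[eps_gt0 eps_lt1] _] := ric.
set u := Phi^T *m _ in ident regul.
have [_ Jcard _] := ident; have [J0J comp _] := regul.
have Jn : (#|J| <= n)%N by rewrite Jcard geq_minl.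
have lower : (1 - eps) ^+ 2 * norm2 (v - y) - (1 + eps) * norm2 e <=
    norm2 (restr u (supp v)).
  apply: (correlation_on_support_ge _ _ _ _ _ _ _ ric (subxx _) _ ls).
  by move: vn; rewrite /sparse; have := cardsU (supp v) I; lia.
have upper : norm2 (restr u (J0 :\: supp v)) <=
    2 * eps * norm2 (v - y) + (1 + eps) * norm2 e.
  rewrite /u addrAC -mulmxBr.
  apply: (correlation_off_support_le _ _ _ _ _ (supp v :|: I) ric).
  - by apply: subset_trans (suppD _ _) _; rewrite suppN setUSS.
  - rewrite disjoint_subset; apply/subsetP => i; rewrite !inE => /andP[vi iJ0].
    rewrite negb_or vi /=; apply/negP => iI.
    have := disjointFr (identify_disjoint _ _ _ _ _ ls ident) iI.
    by rewrite (subsetP J0J).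
  have := cardsU (J0 :\: supp v) (supp v :|: I); have := cardsU (supp v) I.
  have := subset_leq_card (subsetDl J0 (supp v)); have := subset_leq_card J0J.
  by move: vn; rewrite /sparse; lia.
have [p np p_ln] := @exists_dyadic_bound R n n_ge2.
have energy := regularize_energy _ _ _ regul (leq_trans Jn np).
have {energy} energy : norm2 (restr u J) ^+ 2 <= 6 * s ^+ 2 * norm2 (restr u J0) ^+ 2.
  by apply: le_trans energy _; rewrite ler_wpM2r ?sqr_ge0 // sE.
have mass := comparable_energy _ _ _ comp half.
have ident_e := identify_energy _ _ _ ident vn.
have s_ge : 7 / 10 <= s.
  rewrite -ler_sqr ?nnegrE // ?sE; last by lra.
  have : ln 2 <= ln (n%:R : R) by rewrite ler_ln ?posrE ?ltr0n ?ler_nat //; lia.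
  have := @ln2_ge_half R; lra.
(* The energy estimates lose a factor 6 s^2 * 5 = 30 s^2, and 30 <= (11/2)^2. *)
have {mass energy ident_e} u_le : norm2 (restr u (supp v)) <=
    11 / 2 * s * norm2 (restr u (J0 :\: supp v)).
  apply: le_trans ident_e _.
  have s2 := sqr_ge0 s.
  have mass2 := ler_wpM2l s2 mass.
  have b_ge0 := norm2_ge0 (restr u (J0 :\: supp v)).
  rewrite -ler_sqr ?nnegrE ?norm2_ge0 ?mulr_ge0 // ?exprMn; last by lra.
  have : 0 <= s ^+ 2 * norm2 (restr u (J0 :\: supp v)) ^+ 2.
    by rewrite mulr_ge0 ?sqr_ge0.
  lra.
have eps_le : eps <= 1 / 70 by nra.
have W_ge0 := norm2_ge0 (v - y); have E_ge0 := norm2_ge0 e.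
(* Only s * eps = 1/100 makes the term in W on the right absorbable. *)
have := ler_wpM2l s_ge0 upper.
set W := norm2 (v - y) in lower upper W_ge0 *; set E := norm2 e in lower upper E_ge0 *.
have -> : s * (2 * eps * W + (1 + eps) * E) = 2 * (eps * s) * W + (s + eps * s) * E.
  by ring.
rewrite eps_s => upper_s.
have : 7 / 10 * E <= s * E by rewrite ler_wpM2r.
have : eps * E <= 1 / 70 * E by rewrite ler_wpM2r.
have : eps * W <= 1 / 70 * W by rewrite ler_wpM2r.
have : 0 <= eps ^+ 2 * W by rewrite mulr_ge0 ?sqr_ge0.
lra.
Qed.

(** The alternative is what makes the invariant survive: the number of correct
selections grows with every good step, while after a bad step the bound on the
missed part persists as I grows. *)
Lemma romp_run_invariant {R : realType} {N d n : nat} (Phi : 'M[R]_(N, d))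
    (s eps : R) (v : 'cV[R]_d) (e : 'cV[R]_N) (k : nat) (I : {set 'I_d})
    (y : 'cV[R]_d) :
  (2 <= n)%N -> 0 <= s -> s ^+ 2 = ln n%:R -> eps * s = 1 / 100 ->
  RIC Phi (4 * n)%N eps -> sparse n v ->
  romp_run Phi (Phi *m v + e) n k I y ->
  [/\ least_squares Phi (Phi *m v + e) I y,
      (#|I| <= 3 * n)%N &
      (k <= #|I :&: supp v|)%N && (#|I| <= 2 * #|I :&: supp v|)%N \/
      norm2 (restr v (~: I)) <= 10 * s * norm2 e].
Proof.
move=> n_ge2 s_ge0 sE eps_s ric vn.
elim=> [|{}k {}I {}y I' y' _ [ls I3n IHk] _ I2n [J [J0 [ident regul -> ls']]]].
  split; rewrite ?cards0 //; last by left; rewrite set0I cards0.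
  split=> [|z z0]; first by apply/subsetP => i; rewrite inE mxE eqxx.
  suff -> : z = 0 by [].
  by apply/colP => i; rewrite (supp_subset_eq0 _ _ _ z0) ?mxE ?inE.
have [_ Jcard _] := ident; have [J0J _ _] := regul.
have J0n : (#|J0| <= n)%N.
  by rewrite (leq_trans (subset_leq_card J0J)) // Jcard geq_minl.
have IJ0 : I :&: J0 = set0.
  apply/eqP; rewrite setI_eq0.
  exact: disjointWr J0J (identify_disjoint _ _ _ _ _ ls ident).
have cardU : #|I :|: J0| = (#|I| + #|J0|)%N by rewrite cardsU IJ0 cards0 subn0.
split=> //; first by rewrite cardU; lia.
have shrink : norm2 (restr v (~: (I :|: J0))) <= norm2 (restr v (~: I)).
  by apply: norm2_restr_le; rewrite setCS subsetUl.
case: IHk => [/andP[kI II]|err]; last by right; apply: le_trans err.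
have [half|hit] := leqP #|J0 :&: supp v| #|J0 :\: supp v|.
  right; apply: le_trans shrink _.
  have err := missed_step_error _ _ _ _ _ _ _ _ _ n_ge2 s_ge0 sE eps_s ric vn
    (ltnW I2n) ls ident regul half.
  have [yI _] := ls; apply: le_trans err.
  by rewrite -(restr_setC_subr _ _ _ yI) norm2_restr_le_full.
left; have cardUS : #|(I :|: J0) :&: supp v| =
    (#|I :&: supp v| + #|J0 :&: supp v|)%N.
  by rewrite setIUl cardsU -setIIl IJ0 set0I cards0 subn0.
by have := cardsID (supp v) J0; lia.
Qed.

Theorem theorem1p2 (R : realType) (N d n : nat) (hn : (2 <= n)%N)
    (Phi : 'M[R]_(N, d))
    (hPhi : RIC Phi (4 * n)%N (1 / 100 / Num.sqrt (ln (n%:R : R))))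
    (v : 'cV[R]_d) (hv : sparse n v) (e : 'cV[R]_N)
    (I : {set 'I_d}) (vhat : 'cV[R]_d)
    (hout : romp_output Phi (Phi *m v + e) n I vhat) :
  norm2 (v - vhat) <= 104 * Num.sqrt (ln (n%:R : R)) * norm2 e.
Proof.
have ln_ge : 1 / 2 <= ln (n%:R : R).
  by apply: le_trans ln2_ge_half _; rewrite ler_ln ?posrE ?ltr0n ?ler_nat //; lia.
move: hPhi; set s := Num.sqrt _; set eps := _ / s => ric.
have s_ge0 : 0 <= s by apply: sqrtr_ge0.
have sE : s ^+ 2 = ln n%:R by rewrite sqr_sqrtr //; lra.
have s_ge : 7 / 10 <= s by rewrite -ler_sqr ?nnegrE // ?sE; lra.
have eps_s : eps * s = 1 / 100 by rewrite divfK // gt_eqF //; lra.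
case: hout => k run stop.
have [ls I3n missed] := romp_run_invariant _ _ _ _ _ _ _ _ hn s_ge0 sE eps_s ric hv run.
have vIc : norm2 (restr v (~: I)) <= 10 * s * norm2 e.
  case: missed => [/andP[kI II]|//].
  have : (#|supp v| <= #|I :&: supp v|)%N.
    by apply: leq_trans hv _; case: stop; lia.
  move=> le_card; have vI : supp v \subset I.
    by apply/setIidPr/eqP; rewrite eqEcard subsetIr.
  by rewrite restr_setC_eq0 // norm2_0 !mulr_ge0 ?norm2_ge0.
have vI4n : (#|supp v :|: I| <= 4 * n)%N.
  by move: hv; rewrite /sparse; have := cardsU (supp v) I; lia.
have err := least_squares_error _ _ _ _ _ _ ric vI4n ls.
have [/andP[eps_gt0 _] _] := ric.
have eps_le : eps <= 1 / 70 by nra.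
have W_ge0 := norm2_ge0 (v - vhat); have E_ge0 := norm2_ge0 e.
have := ler_wpM2r W_ge0 eps_le; have := ler_wpM2r E_ge0 s_ge.
have := ler_wpM2r (norm2_ge0 (restr v (~: I))) eps_le; lra.
Qed.
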